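(* There exist a closed subset $E$ of $\mathbb{R}^2$ (with a distinguished point $x_0\in E$) and a sequence of $1$-jets $\{(f_j, G_j)\}_{j\in\mathbb{N}}$ on $E$ (that is, $f_j:E\to\mathbb{R}$ and $G_j:E\to\mathbb{R}^2$) such that: (1) There exists a sequence $\{F_j\}_{j\in\mathbb{N}}$ of convex functions of class $C^{1,1}_{\mathrm{loc}}(\mathbb{R}^2)$ such that $(F_j, \nabla F_j)_{|_{E}}=(f_j, G_j)$ for all $j\in\mathbb{N}$. (2) For every $k\in\mathbb{N}\cup\{0\}$ we have that $\sup_{j\in\mathbb{N}}\rho^{W}_{k, E}(f_j, G_j)<\infty$, $\sup_{j\in\mathbb{N}}\rho^{CW}_{k, E}(f_j, G_j)<\infty$, and $\sup_{j\in\mathbb{N}}\mu_{k, E}(f_j, G_j)<\infty$. (3) For every sequence $\{H_j\}_{j\in\mathbb{N}}$ of convex functions of class $C^{1,1}_{\mathrm{loc}}(\mathbb{R}^2)$ such that $(H_j, \nabla H_j)_{|_{E}}=(f_j, G_j)$ for all $j$, we have that $\sup_{j\in\mathbb{N}}\rho_{k}(H_j)=\infty$ for some $k\geq 1$.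
   Context: $\mathbb{N}=\{1,2,\dots\}$; $B(x,r)$ is the closed Euclidean ball. $C^{1,1}_{\mathrm{loc}}$ is the class of differentiable functions whose gradient is Lipschitz on every ball. Fix the distinguished point $x_0\in E$. For $H\in C^{1,1}_{\mathrm{loc}}(\mathbb{R}^2)$ and $k\ge1$, $\rho_k(H)=\mathrm{Lip}(\nabla H_{|B(x_0,k)})$. For a $1$-jet $(f,G)$ on $E$ set $\rho^{W}_{0,E}(f,G)=\rho^{CW}_{0,E}(f,G)=\mu_{0,E}(f,G)=|f(x_0)|+|G(x_0)|$, and for $k\geq 1$ (with $\inf\emptyset=\infty$): $\rho^{W}_{k,E}(f,G)$ is the infimum of all $M>0$ such that $|f(x)-f(y)-\langle G(y),x-y\rangle|\le \frac12M|x-y|^2$ and $|G(x)-G(y)|\le M|x-y|$ for all $x,y\in E\cap B(x_0,k)$. $\rho^{CW}_{k,E}(f,G)$ is the infimum of all $M>0$ such that $f(z)+\langle G(z),x-z\rangle\le f(y)+\langle G(y),x-y\rangle+\frac M2|x-y|^2$ for all $y,z\in E\cap B(x_0,k)$ and all $x\in\mathbb{R}^2$. $\mu_{k,E}(f,G)$ is the infimum, over all admissible systems for $(f,G)$, of $$\sup\left\{\frac{|\nabla\varphi_y(u)-\nabla\varphi_y(v)|}{|u-v|} : y\in E^*\cap P^{-1}(B_X(P(x_0),k)),\ u,v\in B_X(P(x_0),k),\ u\ne v\right\}.$$ Here $B_X$ denotes closed balls in $X$ and an admissible system consists of: a linear subspace $X$ of $\mathbb{R}^2$, with orthogonal projection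 $P:\mathbb{R}^2\to X$, containing $Y:=\mathrm{span}\{G(y)-G(z):y,z\in E\}$; a set $E^*$ equal to $E$ if $\dim Y=\dim X$, and equal to $E\cup\{p_1,\dots,p_m\}$ with $m=\dim X-\dim Y$ and $p_1,\dots,p_m\in\mathbb{R}^2\setminus E$ otherwise; numbers $t_y$ and vectors $\xi_y\in\mathbb{R}^2$ for $y\in E^*$, with $t_y=f(y)$, $\xi_y=G(y)$ for $y\in E$ (arbitrary for $y=p_i$); and functions $\varphi_y:X\to[0,\infty)$, $y\in E^*$, of class $C^{1,1}_{\mathrm{loc}}$, such that: $\mathrm{span}\{\xi_y-\xi_z:y,z\in E^*\}=X$; $\varphi_y(P(y))=0$ and $\nabla\varphi_y(P(y))=0$ for all $y\in E^*$; for every $R>0$ the supremum of $|\nabla\varphi_y(u)-\nabla\varphi_y(v)|/|u-v|$ over $y\in E^*\cap P^{-1}(B_X(0,R))$, $u\neq v$ in $B_X(0,R)$, is finite; and $t_z+\langle\xi_z,x-z\rangle\le t_y+\langle\xi_y,x-y\rangle+\varphi_y(P(x))$ for all $y,z\in E^*$, $x\in\mathbb{R}^2$. *)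

(* Defs.v *)
From HB Require Import structures.
From mathcomp Require Import all_boot all_order all_algebra.
From mathcomp Require Import all_classical all_reals all_analysis.
Set Implicit Arguments.
Unset Strict Implicit.
Unset Printing Implicit Defensive.
Import Order.TTheory GRing.Theory Num.Theory.
Import numFieldNormedType.Exports.
Local Open Scope classical_set_scope.
Local Open Scope ring_scope.

(* The library norm on 'rV[R]_n is the sup norm.  It is used only for the
   topology and for differentiability; every metric quantity below is measured
   with the Euclidean norm [inorm dot]. *)
Definition dot (R : realType) n (u v : 'rV[R]_n) : R :=
  \sum_(i < n) u 0 i * v 0 i.

(* A linear subspace X of R^n as a normed module, so that [differentiable] and
   ['d] apply to functions defined on X only.  In finite dimension the choice
   of the norm (here the restriction of the norm of 'rV[R]_n) is irrelevant for
   these notions. *)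
Section SubspaceNorm.
Context {R : realType} {n : nat} (X : {vspace 'rV[R]_n}).

Let subvs_norm (u : subvs_of X) : R := `|vsval u|.

Let subvs_normD u v : subvs_norm (u + v) <= subvs_norm u + subvs_norm v.
Proof. by rewrite /subvs_norm linearD ler_normD. Qed.

Let subvs_norm0_eq0 u : subvs_norm u = 0 -> u = 0.
Proof. by move=> /normr0_eq0 u0; apply: val_inj; rewrite /= u0. Qed.

Let subvs_normMn u k : subvs_norm (u *+ k) = subvs_norm u *+ k.
Proof. by rewrite /subvs_norm linearMn normrMn. Qed.

Let subvs_normN u : subvs_norm (- u) = subvs_norm u.
Proof. by rewrite /subvs_norm linearN normrN. Qed.

HB.instance Definition _ := Num.Zmodule_isNormed.Build R (subvs_of X)
  subvs_normD subvs_norm0_eq0 subvs_normMn subvs_normN.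

HB.instance Definition _ := isPointed.Build (subvs_of X) 0.

HB.instance Definition _ :=
  PseudoMetric.copy (subvs_of X) (pseudoMetric_normed (subvs_of X)).

HB.instance Definition _ :=
  NormedZmod_PseudoMetric_eq.Build R (subvs_of X) erefl.

Let subvs_normZ (a : R) (u : subvs_of X) : `|a *: u| = `|a| * `|u|.
Proof. by rewrite /Num.norm /= /subvs_norm linearZ normrZ. Qed.

HB.instance Definition _ :=
  PseudoMetricNormedZmod_Lmodule_isNormedModule.Build R (subvs_of X)
    subvs_normZ.

Definition subdot (u v : subvs_of X) : R := dot (vsval u) (vsval v).

End SubspaceNorm.

(* Supremum of a set of nonnegative quantities, computed in [0, +oo], so that
   the supremum of the empty set is 0. *)
Definition esup0 (R : realType) (A : set (\bar R)) : \bar R :=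
  ereal_sup (0%E |` A).

(* Notions relative to an inner product [ip]: [dot] on R^2, or [subdot] on a
   subspace. *)
Section InnerProduct.
Context {R : realType} {V : normedModType R} (ip : V -> V -> R).

Definition inorm (v : V) : R := Num.sqrt (ip v v).

Definition cball (c : V) (r : R) : set V := [set v | inorm (v - c) <= r].

(* The gradient in the sense of the Riesz representation; meaningful when phi is
   differentiable at u. *)
Definition grad (phi : V -> R) (u : V) : V :=
  xget 0 [set g | forall h, 'd phi u h = ip g h].

Definition quotients (g : V -> V) (D : set V) : set (\bar R) :=
  [set q | exists u v, [/\ D u, D v, u != v &
     q = (inorm (g u - g v) / inorm (u - v))%:E]].

Definition Lip (g : V -> V) (D : set V) : \bar R := esup0 (quotients g D).

Definition C11loc (phi : V -> R) : Prop :=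
  (forall u, differentiable phi u) /\
  (forall c r, (Lip (grad phi) (cball c r) < +oo)%E).

End InnerProduct.

Definition is_span (R : realType) n (S : set 'rV[R]_n)
    (X : {vspace 'rV[R]_n}) : Prop :=
  forall v, v \in X <->
    exists2 s : seq 'rV[R]_n, (forall w, w \in s -> S w) & v \in span s.

Definition diffs (R : realType) n (D : set 'rV[R]_n)
    (g : 'rV[R]_n -> 'rV[R]_n) : set 'rV[R]_n :=
  [set w | exists y z, [/\ D y, D z & w = g y - g z]].

Definition convex_C11loc (R : realType) (F : 'rV[R]_2 -> R) : Prop :=
  convex_function [set: convex_lmodType 'rV[R]_2] F /\ C11loc (@dot R 2) F.

(* A jet on E is given by total functions (f, G); only their values on E are
   ever used. *)
Definition interpolates (R : realType) (E : set 'rV[R]_2) (F f : 'rV[R]_2 -> R)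
    (G : 'rV[R]_2 -> 'rV[R]_2) : Prop :=
  forall x, E x -> F x = f x /\ grad (@dot R 2) F x = G x.

Definition rho (R : realType) (x0 : 'rV[R]_2) (k : nat) (H : 'rV[R]_2 -> R) :
    \bar R :=
  Lip (@dot R 2) (grad (@dot R 2) H) (cball (@dot R 2) x0 k%:R).

Section Jets.
Context {R : realType}.
Local Notation V := 'rV[R]_2.
Local Notation norm2 := (inorm (@dot R 2)).
Local Notation ball2 := (cball (@dot R 2)).

Variables (E : set V) (x0 : V) (f : V -> R) (G : V -> V).

Definition rho0 : \bar R := (`|f x0| + norm2 (G x0))%:E.

Definition rhoW (k : nat) : \bar R :=
  if k is 0 then rho0 else
  ereal_inf [set M%:E | M in [set M : R | 0 < M /\
    forall x y, (E `&` ball2 x0 k%:R) x -> (E `&` ball2 x0 k%:R) y ->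
      `|f x - f y - dot (G y) (x - y)| <= 2^-1 * M * norm2 (x - y) ^+ 2 /\
      norm2 (G x - G y) <= M * norm2 (x - y)]].

Definition rhoCW (k : nat) : \bar R :=
  if k is 0 then rho0 else
  ereal_inf [set M%:E | M in [set M : R | 0 < M /\
    forall y z x, (E `&` ball2 x0 k%:R) y -> (E `&` ball2 x0 k%:R) z ->
      f z + dot (G z) (x - z) <=
      f y + dot (G y) (x - y) + M / 2 * norm2 (x - y) ^+ 2]].

(* sup of |grad phi_y(u) - grad phi_y(v)| / |u - v| over
   y in Es /\ P^-1(B_X(c, r)) and u <> v in B_X(c, r). *)
Definition phi_slope (X : {vspace V}) (P : V -> subvs_of X) (Es : set V)
    (phi : V -> subvs_of X -> R) (c : subvs_of X) (r : R) : \bar R :=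
  let B := cball (@subdot R 2 X) c r in
  esup0 (\bigcup_(y in Es `&` P @^-1` B)
    quotients (@subdot R 2 X) (grad (@subdot R 2 X) (phi y)) B).

(* The families t, xi and phi are indexed by all of R^2, but only the indices
   in E* = E U {p_1, ..., p_m} matter; when m = dim X - dim Y = 0 the range of
   [adm_p] is empty, so that E* = E. *)
Record admissible_system := AdmissibleSystem {
  adm_X : {vspace V};
  adm_P : V -> subvs_of adm_X;
  adm_Y : {vspace V};
  adm_p : 'I_(\dim adm_X - \dim adm_Y) -> V;
  adm_Es : set V := E `|` range adm_p;
  adm_t : V -> R;
  adm_xi : V -> V;
  adm_phi : V -> subvs_of adm_X -> R;
  adm_P_orth : forall x (u : subvs_of adm_X),
    dot (x - vsval (adm_P x)) (vsval u) = 0;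
  adm_Y_span : is_span (diffs E G) adm_Y;
  adm_Y_sub_X : (adm_Y <= adm_X)%VS;
  adm_p_notin : forall i, ~ E (adm_p i);
  adm_tE : forall y, E y -> adm_t y = f y;
  adm_xiE : forall y, E y -> adm_xi y = G y;
  adm_phi_ge0 : forall y, adm_Es y -> forall u, 0 <= adm_phi y u;
  adm_phi_C11 : forall y, adm_Es y -> C11loc (@subdot R 2 adm_X) (adm_phi y);
  adm_xi_span : is_span (diffs adm_Es adm_xi) adm_X;
  adm_phi_P : forall y, adm_Es y ->
    adm_phi y (adm_P y) = 0 /\
    grad (@subdot R 2 adm_X) (adm_phi y) (adm_P y) = 0;
  adm_slope_fin : forall r : R, 0 < r ->
    (phi_slope adm_P adm_Es adm_phi 0%R r < +oo)%E;
  adm_ineq : forall y z x, adm_Es y -> adm_Es z ->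
    adm_t z + dot (adm_xi z) (x - z) <=
    adm_t y + dot (adm_xi y) (x - y) + adm_phi y (adm_P x)
}.

Definition mu (k : nat) : \bar R :=
  if k is 0 then rho0 else
  ereal_inf [set phi_slope (@adm_P S) (adm_Es S) (@adm_phi S)
                   (adm_P S x0) k%:R | S in [set: admissible_system]].

End Jets.

(* Main.v *)
(* On the pair of hyperbolas E = {(s, h) : (s h)^2 = 1} take, for d -> 0, the
   1-jet of F_d(s, h) = sqrt(s^2 + d^2) + (d^3 / 2) h^2.  At (s, h) in E the
   tangent plane plus (1 + |h|) / 2 times the squared distance majorizes F_d,
   because 1 / |s| = |h|; so all local constants are bounded uniformly in d.
   The vanishing term d^3 h^2 / 2 makes the gradients span R^2, which lets the
   admissible systems use X = R^2, where only points of a bounded part of E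
   count.  But any convex extension H is at most 3 d at the origin, the midpoint
   of (d, 1/d) and (-d, -1/d), while the tangents at (1, 1) and (-1, 1) give
   H(+-s, 0) >= (s - d) / 2: in the limit H has a corner at the origin. *)
Require Import Defs.
From HB Require Import structures.
From mathcomp Require Import all_boot all_order all_algebra.
From mathcomp Require Import all_classical all_reals all_analysis.
From mathcomp Require Import ring lra.
Set Implicit Arguments.
Unset Strict Implicit.
Unset Printing Implicit Defensive.
Import Order.TTheory GRing.Theory Num.Theory.
Import numFieldNormedType.Exports.
Local Open Scope classical_set_scope.
Local Open Scope ring_scope.

(** * Gradients from quadratic remainders, and tangent planes of convex functions *)

Lemma dotE (R : realType) (u v : 'rV[R]_2) :
  dot u v = u 0 0 * v 0 0 + u 0 1 * v 0 1.
Proof.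
by rewrite /dot big_ord_recl big_ord1; congr (_ + u 0 _ * v 0 _); apply: val_inj.
Qed.

(** A remainder of second order is little-o, so [ip g] is the differential, and nondegeneracy of
    [ip] leaves [g] as the only value for [xget]. The form [ip] is abstract so as to cover both
    [dot] and [subdot]. *)
Lemma quadratic_remainder_grad (R : realType) (V : normedModType R)
    (ip : V -> V -> R) (phi : V -> R) (u g : V) (C K : R) :
  linear (ip g) -> (forall h, `|ip g h| <= K * `|h|) ->
  (forall a b, (forall h, ip a h = ip b h) -> a = b) ->
  (forall v, `|phi v - phi u - ip g (v - u)| <= C * `|v - u| ^+ 2) ->
  differentiable phi u /\ grad ip phi u = g.
Proof.
move=> lin bnd ndg rem.
pose L : {linear V -> R} := HB.pack (ip g) (GRing.isLinear.Build _ _ _ _ (ip g) lin).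
have Lc : continuous L.
  apply/bounded_linear_continuous/linear_boundedP.
  exists K; split; first exact: num_real.
  by move=> r /ltW Kr x; apply: (le_trans (bnd x)); rewrite ler_wpM2r.
have e : phi \o shift u = cst (phi u) + L +o_ 0 id.
  apply/eqaddoP => _/posnumP[e].
  (* The sign of [C] is unknown; |C| + 1 is positive and dominates it. *)
  have C1 : 0 < `|C| + 1 by rewrite ltr_wpDl.
  near=> h.
  have -> : (phi \o shift u - (cst (phi u) + L)) h =
    phi (h + u) - phi u - ip g (h + u - u).
    by rewrite addrK -addrA -opprD.
  apply: (le_trans (rem _)); rewrite addrK expr2 mulrA ler_wpM2r//.
  apply: (@le_trans _ _ ((`|C| + 1) * `|h|)).
    by rewrite ler_wpM2r// ler_wpDr// ler_norm.
  by rewrite mulrC -ler_pdivlMr.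
have dE := diff_unique Lc e.
split; first by apply/diff_locallyP; rewrite dE.
rewrite /grad; case: xgetP => [y _ /= Hy|/(_ g)].
  by apply: ndg => h; rewrite -Hy dE.
by case => h; rewrite dE.
Unshelve. all: by end_near. Qed.

(** The row of values of the differential on the basis is a Riesz representative, so [xget] never
    falls back on its default 0. *)
Lemma grad_dotE (R : realType) n (phi : 'rV[R]_n -> R) (u h : 'rV[R]_n) :
  'd phi u h = dot (grad (@dot R n) phi u) h.
Proof.
rewrite /grad; case: xgetP => [y _ /= -> //|].
move=> /(_ (\row_i 'd phi u (delta_mx 0 i))) []; move=> v.
rewrite [in LHS](row_sum_delta v) linear_sum; apply: eq_bigr => i _.
by rewrite linearZ mxE mulrC.
Qed.

Lemma convex_functionTP (R : realType) (V : lmodType R) (H : V -> R) :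
  convex_function [set: convex_lmodType V] H <->
  forall t x y, 0 <= t <= 1 ->
    H (t *: x + (1 - t) *: y) <= t * H x + (1 - t) * H y.
Proof.
split=> [cH t x y /andP[t0 t1]|cH t x y _ _]; last first.
  by rewrite convRE; apply: (cH t%:num); rewrite ge0 le1.
have := cH (Itv01 t0 t1) x y; rewrite !inE => /(_ I I).
by rewrite convRE.
Qed.

(** By convexity the difference quotient at [y] along [x - y] is at most [H x - H y] for small
    positive steps; the directional derivative is its limit. *)
Lemma convex_tangent (R : realType) n (H : 'rV[R]_n -> R) (y x : 'rV[R]_n) :
  convex_function [set: convex_lmodType 'rV[R]_n] H -> differentiable H y ->
  H y + dot (grad (@dot R n) H y) (x - y) <= H x.
Proof.
move=> cH dH; rewrite -grad_dotE -deriveE// -lerBrDl.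
have := diff_derivable (v := x - y) dH; rewrite /derivable /derive.
set F := (fun _ => _) => cF.
have {cF}/cvg_dnbhs_at_right cF : F @ 0^' --> lim (F @ 0^') by [].
apply: (cvgr_to_le cF); near=> t.
have t0 : 0 < t by [].
have t01 : 0 <= t <= 1.
  by rewrite ltW//=; near: t; exact: nbhs_right_ltW.
rewrite /F /= -[_ *: _]/(_ * _) mulrC ler_pdivrMr//.
have -> : t *: (x - y) + y = t *: x + (1 - t) *: y.
  by rewrite scalerBr scalerBl scale1r -addrA [- _ + _]addrC.
have := (convex_functionTP H).1 cH t x y t01; lra.
Unshelve. all: by end_near. Qed.

(** The tangent is taken at the convex combination itself: weighting its values at [x] and [y] by
    [t] and [1 - t] cancels the linear terms. *)
Lemma tangent_convex (R : realType) n (F : 'rV[R]_n -> R)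
    (g : 'rV[R]_n -> 'rV[R]_n) :
  (forall w z, F w + dot (g w) (z - w) <= F z) ->
  convex_function [set: convex_lmodType 'rV[R]_n] F.
Proof.
move=> tg; apply/convex_functionTP => t x y /andP[t0 t1].
set w := _ + _.
have dz (a b : R) : a *: (x - w) + b *: (y - w) = 0 ->
    a * dot (g w) (x - w) + b * dot (g w) (y - w) = 0.
  rewrite /dot !mulr_sumr -big_split /= => e; apply: big1 => i _.
  have /matrixP /(_ 0 i) := e; rewrite !mxE => /(congr1 ( *%R (g w 0 i))).
  by rewrite mulr0 => <-; ring.
have e : t *: (x - w) + (1 - t) *: (y - w) = 0.
  rewrite !scalerBr addrACA -opprD -[X in _ - X]scalerDl.
  by rewrite [t + _]addrC subrK scale1r subrr.
have := dz _ _ e.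
have := ler_wpM2l t0 (tg w x).
have t1' : 0 <= 1 - t by rewrite subr_ge0.
have := ler_wpM2l t1' (tg w y); lra.
Qed.

Lemma dot_norm_le (R : realType) n (g h : 'rV[R]_n) :
  `|dot g h| <= (\sum_i `|g 0 i|) * `|h|.
Proof.
rewrite /dot mulr_suml; apply: (le_trans (ler_norm_sum _ _ _)).
apply: ler_sum => i _; rewrite normrM ler_wpM2l//.
by rewrite [leRHS]mx_normrE (le_bigmax _ (fun i => `|h i.1 i.2|) (0, i)).
Qed.

(** * The function sqrt(s^2 + d^2), a smooth approximation of |s| *)

Definition hyp (R : realType) (d s : R) : R := Num.sqrt (s ^+ 2 + d ^+ 2).

Section Hyp.
Variables (R : realType) (d : R).
Hypothesis d0 : 0 < d.
Implicit Types s t : R.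

Lemma hyp_sqr s : hyp d s ^+ 2 = s ^+ 2 + d ^+ 2.
Proof. by rewrite sqr_sqrtr// addr_ge0 ?sqr_ge0. Qed.

Lemma hyp_gt0 s : 0 < hyp d s.
Proof. by rewrite sqrtr_gt0 ltr_wpDl ?sqr_ge0 ?exprn_gt0. Qed.

Lemma norm_le_hyp s : `|s| <= hyp d s.
Proof. by rewrite -sqrtr_sqr ler_wsqrtr// lerDl sqr_ge0. Qed.

Lemma le_hyp s : d <= hyp d s.
Proof.
by rewrite -[leLHS]gtr0_norm// -sqrtr_sqr ler_wsqrtr// lerDr sqr_ge0.
Qed.

(** Multiplied by [hyp d s], this is the Cauchy-Schwarz inequality for (s, d) and (t, d). *)
Lemma hyp_tangent s t : hyp d s + s / hyp d s * (t - s) <= hyp d t.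
Proof.
have a0 := hyp_gt0 s; have b0 := hyp_gt0 t.
have ab : s * t + d ^+ 2 <= hyp d s * hyp d t.
  apply: (le_trans (ler_norm _)).
  rewrite -(ler_pXn2r (n := 2))// ?nnegrE ?mulr_ge0// ?(ltW a0, ltW b0)//.
  rewrite real_normK ?num_real// exprMn !hyp_sqr -subr_ge0.
  rewrite (_ : _ - _ = (d * (s - t)) ^+ 2) ?sqr_ge0//; ring.
rewrite -(ler_pM2l a0).
rewrite (_ : _ * (_ + _) = hyp d s ^+ 2 + s * (t - s)); last by field; rewrite gt_eqF.
by rewrite hyp_sqr; lra.
Qed.

(** Multiplied by [hyp d s], the gap is half the square of [hyp d s - hyp d t]. The curvature
    depends on the base point [s] only and, for nonzero [s], is below 1/|s| whatever [d]. *)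
Lemma hyp_upper s t :
  hyp d t <= hyp d s + s / hyp d s * (t - s) + (t - s) ^+ 2 / (2 * hyp d s).
Proof.
have a0 := hyp_gt0 s.
rewrite -(ler_pM2l a0) -subr_ge0.
rewrite (_ : _ - _ = (hyp d s ^+ 2 *+ 2 + s * (t - s) *+ 2 + (t - s) ^+ 2 -
    (hyp d s * hyp d t) *+ 2) / 2); last by field; rewrite gt_eqF.
have := sqr_ge0 (hyp d s - hyp d t).
rewrite sqrrB !hyp_sqr => h; rewrite divr_ge0//; lra.
Qed.

Lemma hyp_dist s t : `|hyp d s - hyp d t| <= `|s - t|.
Proof.
wlog st : s t / hyp d t <= hyp d s => [wl|].
  have [/wl//|/ltW /wl] := leP (hyp d t) (hyp d s).
  by rewrite distrC (distrC t).
rewrite ger0_norm ?subr_ge0//.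
have := hyp_tangent s t.
rewrite -lerBrDl -lerN2 !opprB -mulrN opprB => h; apply: (le_trans h).
apply: (le_trans (ler_norm _)); rewrite normrM ler_piMl// normrM normfV.
by rewrite (gtr0_norm (hyp_gt0 s)) ler_pdivrMr ?hyp_gt0// mul1r norm_le_hyp.
Qed.

(** The difference is rewritten over the single denominator [hyp d s]; each of the two terms of the
    numerator is at most |s - t|, whence the 2. *)
Lemma hyp_grad_dist s t :
  `|s / hyp d s - t / hyp d t| <= 2 / hyp d s * `|s - t|.
Proof.
have a0 := hyp_gt0 s; have b0 := hyp_gt0 t.
have -> : s / hyp d s - t / hyp d t =
  (s - t + t / hyp d t * (hyp d t - hyp d s)) / hyp d s.
  by field; rewrite !gt_eqF.
rewrite normrM normfV (gtr0_norm a0) [2 / _ * _]mulrAC ler_wpM2r ?invr_ge0 ?(ltW a0)//.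
apply: (le_trans (ler_normD _ _)); rewrite mulr_natl mulr2n lerD2l.
rewrite normrM distrC -[leRHS]mul1r ler_pM ?hyp_dist//.
by rewrite normrM normfV (gtr0_norm b0) ler_pdivrMr// mul1r norm_le_hyp.
Qed.

End Hyp.

(** * Algebra of the Euclidean inner product and norm *)

Section DotTheory.
Variables (R : realType) (n : nat).
Implicit Types u v w : 'rV[R]_n.

Lemma dotC u v : dot u v = dot v u.
Proof. by apply: eq_bigr => i _; rewrite mulrC. Qed.

Lemma dot_linear u : linear (dot u).
Proof.
move=> a v w; rewrite /dot scaler_sumr -big_split /=; apply: eq_bigr => i _.
by rewrite !mxE -[_ *: _]/(_ * _); ring.
Qed.

Lemma dotDr u v w : dot u (v + w) = dot u v + dot u w.
Proof. by have := dot_linear u 1 v w; rewrite !scale1r. Qed.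

Lemma dotZr u a v : dot u (a *: v) = a * dot u v.
Proof.
by rewrite /dot mulr_sumr; apply: eq_bigr => i _; rewrite mxE; ring.
Qed.

Lemma dotr0 u : dot u 0 = 0.
Proof. by rewrite -(scale0r 0) dotZr mul0r. Qed.

Lemma dot_ge0 u : 0 <= dot u u.
Proof. by apply: sumr_ge0 => i _; rewrite -expr2 sqr_ge0. Qed.

Lemma dotBl u v w : dot (u - v) w = dot u w - dot v w.
Proof. by rewrite !(dotC _ w) dotDr -scaleN1r dotZr mulN1r. Qed.

Lemma dot_eq0 u : dot u u = 0 -> u = 0.
Proof.
move=> /eqP; rewrite psumr_eq0 => [/allP u0|i _]; last by rewrite -expr2 sqr_ge0.
apply/rowP => i; apply/eqP; rewrite mxE -sqrf_eq0 expr2.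
exact: (u0 i (mem_index_enum i)).
Qed.

(** Turns Euclidean quadratic remainders into remainders for the sup norm, in which
    differentiability is expressed. *)
Lemma dot_sqr_le u : dot u u <= n%:R * `|u| ^+ 2.
Proof.
apply: (le_trans (ler_norm _)); apply: (le_trans (dot_norm_le _ _)).
rewrite expr2 mulrA ler_wpM2r// -[n in n%:R]card_ord -sumr_const mulr_suml.
apply: ler_sum => i _; rewrite mul1r.
by rewrite [leRHS]mx_normrE (le_bigmax _ (fun i => `|u i.1 i.2|) (0, i)).
Qed.

Lemma inorm_ge0 u : 0 <= inorm (@dot R n) u.
Proof. exact: sqrtr_ge0. Qed.

Lemma inorm0 : inorm (@dot R n) 0 = 0.
Proof. by rewrite /inorm dotr0 sqrtr0. Qed.

Lemma inorm_sqr u : inorm (@dot R n) u ^+ 2 = dot u u.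
Proof. by rewrite sqr_sqrtr// dot_ge0. Qed.

Lemma inormZ a u : inorm (@dot R n) (a *: u) = `|a| * inorm (@dot R n) u.
Proof.
by rewrite /inorm dotZr dotC dotZr mulrA -expr2 sqrtrM ?sqr_ge0// sqrtr_sqr.
Qed.

Lemma coord_le_inorm u i : `|u 0 i| <= inorm (@dot R n) u.
Proof.
rewrite -sqrtr_sqr ler_wsqrtr// /dot (bigD1 i)//= -expr2 lerDl.
by apply: sumr_ge0 => k _; rewrite -expr2 sqr_ge0.
Qed.

Lemma grad_dot_quadratic (phi : 'rV[R]_n -> R) u g C :
  (forall v, `|phi v - phi u - dot g (v - u)| <= C * dot (v - u) (v - u)) ->
  differentiable phi u /\ grad (@dot R n) phi u = g.
Proof.
move=> h; apply: (@quadratic_remainder_grad _ _ _ _ _ _ (`|C| * n%:R)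
   (\sum_i `|g 0 i|)).
- exact: dot_linear.
- exact: dot_norm_le.
- by move=> a b e; apply/subr0_eq/dot_eq0; rewrite dotBl e subrr.
move=> v; apply: (le_trans (h v)); rewrite -mulrA.
apply: (le_trans (y := `|C| * dot (v - u) (v - u))).
  by rewrite ler_wpM2r ?dot_ge0// ler_norm.
by rewrite ler_wpM2l// dot_sqr_le.
Qed.

Variable X : {vspace 'rV[R]_n}.

Lemma grad_subdot_quadratic (phi : subvs_of X -> R) (u g : subvs_of X) C :
  (forall v : subvs_of X,
    `|phi v - phi u - subdot g (v - u)| <= C * subdot (v - u) (v - u)) ->
  differentiable phi u /\ grad (@subdot R n X) phi u = g.
Proof.
move=> h; apply: (@quadratic_remainder_grad _ _ _ _ _ _ (`|C| * n%:R)
   (\sum_i `|vsval g 0 i|)).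
- by move=> a v w; rewrite /subdot linearP dot_linear.
- by move=> v; exact: dot_norm_le.
- move=> a b e; apply/val_inj/subr0_eq/dot_eq0.
  by rewrite dotBl -linearB; apply/eqP; rewrite subr_eq0; apply/eqP/e.
move=> v; apply: (le_trans (h v)); rewrite -mulrA.
apply: (le_trans (y := `|C| * subdot (v - u) (v - u))).
  by rewrite ler_wpM2r ?dot_ge0// ler_norm.
by rewrite ler_wpM2l// dot_sqr_le.
Qed.

End DotTheory.

(** * Lipschitz constants as suprema of quotients *)

Lemma Lip_le (R : realType) (V : normedModType R) (ip : V -> V -> R) (g : V -> V)
    (D : set V) (M : R) : 0 <= M ->
  (forall u v, D u -> D v -> inorm ip (g u - g v) <= M * inorm ip (u - v)) ->
  (Lip ip g D <= M%:E)%E.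
Proof.
move=> M0 h; apply: ge_ereal_sup => _ [->|[u [v [Du Dv _ ->]]]].
  by rewrite lee_fin.
rewrite lee_fin; have [] := ltP 0 (inorm ip (u - v)).
  by move=> p; rewrite ler_pdivrMr// h.
(* For an abstract [ip], [u != v] does not exclude a zero denominator; the quotient is then 0 by
   convention. *)
move=> p; have -> : inorm ip (u - v) = 0 by apply/le_anti; rewrite p sqrtr_ge0.
by rewrite invr0 mulr0.
Qed.

Lemma Lip_ge_dist (R : realType) n (g : 'rV[R]_n -> 'rV[R]_n) (D : set 'rV[R]_n)
    (L : R) : (Lip (@dot R n) g D <= L%:E)%E ->
  forall u v, D u -> D v ->
    inorm (@dot R n) (g u - g v) <= L * inorm (@dot R n) (u - v).
Proof.
move=> LL u v Du Dv; have [->|uv] := eqVneq u v.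
  by rewrite !subrr !inorm0 mulr0.
have n0 : 0 < inorm (@dot R n) (u - v).
  rewrite sqrtr_gt0 lt_neqAle dot_ge0 andbT eq_sym.
  by apply: contraNneq uv => /dot_eq0 /subr0_eq ->.
rewrite -ler_pdivrMr// -lee_fin; apply: le_trans LL.
by apply: ereal_sup_ubound; right; exists u, v.
Qed.

(** * The functions [hypF] on the plane and their gradients *)

Definition vec2 (R : realType) (a b : R) : 'rV[R]_2 :=
  \row_i (if i == 0 then a else b).

Definition hypF (R : realType) (d : R) (x : 'rV[R]_2) : R :=
  hyp d (x 0 0) + d ^+ 3 / 2 * x 0 1 ^+ 2.

Definition hypG (R : realType) (d : R) (x : 'rV[R]_2) : 'rV[R]_2 :=
  vec2 (x 0 0 / hyp d (x 0 0)) (d ^+ 3 * x 0 1).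

Section HypF.
Variables (R : realType).
Local Notation norm2 := (inorm (@dot R 2)).
Implicit Types (a b : R) (x y z : 'rV[R]_2).

Lemma vec2E a b : (vec2 a b 0 0 = a) * (vec2 a b 0 1 = b).
Proof. by rewrite !mxE. Qed.

Lemma inorm_le_coords x : norm2 x <= `|x 0 0| + `|x 0 1|.
Proof.
rewrite /inorm dotE -[leRHS]ger0_norm ?addr_ge0// -sqrtr_sqr ler_wsqrtr//.
rewrite -!expr2 -(real_normK (num_real (x 0 0))) -(real_normK (num_real (x 0 1))).
have : 0 <= `|x 0 0| * `|x 0 1| by rewrite mulr_ge0.
by move=> h; rewrite sqrrD; lra.
Qed.

Variable d : R.
Hypothesis d0 : 0 < d.

Lemma hypF_tangent x y : hypF d x + dot (hypG d x) (y - x) <= hypF d y.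
Proof.
have := hyp_tangent d0 (x 0 0) (y 0 0).
have : 0 <= d ^+ 3 / 2 * (y 0 1 - x 0 1) ^+ 2.
  by rewrite mulr_ge0 ?sqr_ge0// divr_ge0// exprn_ge0 ?ltW.
rewrite /hypF dotE /hypG !vec2E !mxE; lra.
Qed.

(** The two coordinates decouple, and [C] has to dominate their curvature constants at [x] only. It
    can thus be chosen global for fixed [d], or local and uniform in [d] on the hyperbolas. *)
Lemma hypF_upper C x y : d ^+ 3 <= C -> (hyp d (x 0 0))^-1 <= C ->
  hypF d y <= hypF d x + dot (hypG d x) (y - x) + C / 2 * dot (y - x) (y - x).
Proof.
move=> h1 h2.
have := hyp_upper d0 (x 0 0) (y 0 0).
rewrite invfM.
have := ler_wpM2r (sqr_ge0 (y 0 0 - x 0 0)) h2.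
have := ler_wpM2r (sqr_ge0 (y 0 1 - x 0 1)) h1.
rewrite /hypF !dotE /hypG !vec2E !mxE; lra.
Qed.

Lemma hypG_lip C x y : d ^+ 3 <= C -> (hyp d (x 0 0))^-1 <= C ->
  norm2 (hypG d x - hypG d y) <= 2 * C * norm2 (x - y).
Proof.
move=> h1 h2.
have C0 : 0 <= C by apply: (le_trans _ h2); rewrite invr_ge0 ltW// hyp_gt0.
have C2 : 0 <= 2 * C by rewrite mulr_ge0.
rewrite /inorm -[2 * C]ger0_norm// -sqrtr_sqr -sqrtrM ?sqr_ge0//.
rewrite ler_wsqrtr// !dotE /hypG !mxE/= -!expr2 mulrDr.
apply: lerD.
  rewrite -exprMn -real_normK ?num_real// -[leRHS]real_normK ?num_real//.
  rewrite ler_pXn2r ?nnegrE//.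
  apply: (le_trans (hyp_grad_dist d0 _ _)); rewrite normrM ler_wpM2r//.
  by rewrite ger0_norm// ler_wpM2l.
rewrite -mulrBr [leLHS]exprMn ler_wpM2r ?sqr_ge0//.
rewrite ler_pXn2r ?nnegrE// ?exprn_ge0 ?(ltW d0)//; lra.
Qed.

(** This constant blows up as [d] tends to 0: it gives the regularity of each single function, not
    the uniform bounds. *)
Let C := d ^+ 3 + d^-1.

Let CP x : d ^+ 3 <= C /\ (hyp d (x 0 0))^-1 <= C.
Proof.
have di : 0 < d^-1 by rewrite invr_gt0.
have d3 : 0 < d ^+ 3 by rewrite exprn_gt0.
split; first by rewrite /C; lra.
have : (hyp d (x 0 0))^-1 <= d^-1 by rewrite lef_pV2 ?posrE ?hyp_gt0// le_hyp.
by rewrite /C; lra.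
Qed.

Lemma hypF_grad x :
  differentiable (hypF d) x /\ grad (@dot R 2) (hypF d) x = hypG d x.
Proof.
apply: (@grad_dot_quadratic _ _ _ _ _ (C / 2)) => y.
have [h1 h2] := CP x.
have := hypF_upper y h1 h2; have := hypF_tangent x y => l u.
by rewrite ger0_norm; lra.
Qed.

Lemma hypF_convex_C11loc : convex_C11loc (hypF d).
Proof.
split; first exact: tangent_convex hypF_tangent.
split=> [x|c r]; first exact: (hypF_grad x).1.
apply: (@le_lt_trans _ _ (2 * C)%:E); last exact: ltry.
apply: Lip_le => [|u v _ _].
  have [h1 h2] := CP 0; apply: mulr_ge0 => //.
  by apply: (le_trans _ h1); rewrite exprn_ge0 ?ltW.
have [h1 h2] := CP u.
by rewrite !(hypF_grad _).2 hypG_lip.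
Qed.

End HypF.

Lemma is_span_fullv (R : realType) (S : set 'rV[R]_2) (a b : R) :
  a != 0 -> b != 0 -> S (vec2 a 0) -> S (vec2 0 b) ->
  is_span S fullv.
Proof.
move=> a0 b0 Sa Sb v; rewrite memvf; split=> // _.
exists [:: vec2 a 0; vec2 0 b].
  by move=> w; rewrite !inE => /orP[] /eqP ->.
have -> : v = (v 0 0 / a) *: vec2 a 0 + (v 0 1 / b) *: vec2 0 b.
  apply/rowP => i; rewrite !mxE.
  have [->|->] : i = 0 \/ i = 1.
    by case: i => [[|[|//]] ?]; [left|right]; apply: val_inj.
  - by rewrite /= mulr0 addr0 divfK.
  - by rewrite /= mulr0 add0r divfK.
by apply: memvD; apply/memvZ/memv_span; rewrite !inE eqxx ?orbT.
Qed.

(** * Bounds on the three jet constants from quadratic majorants of local curvature [c] *)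

Section Quadratic.
Variables (R : realType).
Local Notation V := 'rV[R]_2.
Local Notation norm2 := (inorm (@dot R 2)).
Variables (E : set V) (f : V -> R) (G : V -> V) (c : V -> R).
Hypothesis spanE : is_span (diffs E G) fullv.
Hypothesis c_ge0 : forall y, 0 <= c y.
Hypothesis upper : forall y z x, E y -> E z ->
  f z + dot (G z) (x - z) <=
  f y + dot (G y) (x - y) + c y / 2 * dot (x - y) (x - y).
Hypothesis c_loc : forall r, exists2 M, 0 <= M &
  forall y, E y -> norm2 y <= r -> c y <= M.

Let X : {vspace V} := fullv.
Let phi (y : V) (u : subvs_of X) : R :=
  c y / 2 * dot (vsval u - y) (vsval u - y).

Let vsprojT y : vsval (vsproj X y) = y.
Proof. by rewrite vsprojK ?memvf. Qed.

Let phi_grad y u : differentiable (phi y) u /\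
  grad (@subdot R 2 X) (phi y) u = c y *: (u - vsproj X y).
Proof.
apply: (@grad_subdot_quadratic _ _ _ _ _ _ (c y / 2)) => v.
rewrite /phi /subdot linearB /= vsprojT.
rewrite (_ : _ - _ - _ = c y / 2 * dot (vsval v - vsval u) (vsval v - vsval u)).
  by rewrite ger0_norm// mulr_ge0 ?dot_ge0// divr_ge0.
by rewrite !dotE !mxE; field.
Qed.

Let phi_lip y u v : inorm (@subdot R 2 X)
    (grad (@subdot R 2 X) (phi y) u - grad (@subdot R 2 X) (phi y) v) =
  c y * inorm (@subdot R 2 X) (u - v).
Proof.
rewrite !(phi_grad _ _).2 -scalerBr opprB addrA subrK.
by rewrite /inorm /subdot linearZ /= -/(inorm (@dot R 2) _) inormZ ger0_norm.
Qed.

(** [vsproj X] is the identity of R^2 up to the change of type, so only points of [E] in a Euclidean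
    ball enter the supremum. *)
Let slope_le (x0 : V) k M : 0 <= M ->
  (forall y, E y -> norm2 (y - x0) <= k -> c y <= M) ->
  (phi_slope (vsproj X) E phi (vsproj X x0) k <= M%:E)%E.
Proof.
move=> M0 h; apply: ge_ereal_sup => q [->|[y [Ey By] yq]].
  by rewrite lee_fin.
have cM : c y <= M.
  by apply: h => //; move: By; rewrite /= /cball /= /inorm /subdot linearB /= !vsprojT.
apply: (@le_trans _ _ (Lip (@subdot R 2 X) (grad (@subdot R 2 X) (phi y))
   (cball (@subdot R 2 X) (vsproj X x0) k))).
  by apply: ereal_sup_ubound; right.
by apply: Lip_le => // u v _ _; rewrite phi_lip ler_wpM2r ?sqrtr_ge0.
Qed.

(** The admissible system has X = Y = R^2, no added points, and the quadratics [phi y] centred at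
    [y], whose gradients have Lipschitz constant [c y]. *)
Lemma mu_le_quadratic (x0 : V) (k : nat) M : 0 <= M ->
  (forall y, E y -> norm2 (y - x0) <= k.+1%:R -> c y <= M) ->
  (mu E x0 f G k.+1 <= M%:E)%E.
Proof.
move=> M0 h.
(* The index type is empty because the dimensions agree; the value 0 is a dummy. *)
pose p (_ : 'I_(\dim X - \dim X)) : V := 0.
have I0 : 'I_(\dim X - \dim X) -> False by case=> i; rewrite subnn.
have EsE : E `|` range p = E.
  by apply/seteqP; split=> [x [//|[i]]|x]; [case: (I0 i)|left].
have [S eS] : exists S : admissible_system E f G,
  phi_slope (@adm_P _ _ _ _ S) (adm_Es S) (@adm_phi _ _ _ _ S) (adm_P S x0) k.+1%:R
  = phi_slope (vsproj X) E phi (vsproj X x0) k.+1%:R.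
  unshelve eexists
    (@AdmissibleSystem R E f G X (vsproj X) X p f G phi _ _ _ _ _ _ _ _ _ _ _ _).
  all: rewrite ?EsE //.
  - by move=> x u; rewrite vsprojT subrr dotC dotr0.
  - by move=> y _ u; rewrite mulr_ge0 ?dot_ge0// divr_ge0.
  - move=> y _; split=> [u|w r]; first exact: (phi_grad _ _).1.
    apply: (@le_lt_trans _ _ (c y)%:E); last exact: ltry.
    by apply: Lip_le => // u v _ _; rewrite phi_lip.
  - move=> y _; rewrite (phi_grad _ _).2 subrr scaler0 /phi vsprojT subrr; split=> //.
    by rewrite dotr0 mulr0.
  - move=> r _; have [M' M'0 hM] := c_loc r.
    apply: (@le_lt_trans _ _ M'%:E); last exact: ltry.
    (* The centre 0 is viewed as the projection of 0, so that [slope_le] applies around the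
       origin. *)
    rewrite -(linear0 (vsproj X)); apply: slope_le => // y Ey; rewrite subr0.
    exact: hM.
  - by move=> y z x Ey Ez; rewrite /phi vsprojT upper.
  - by rewrite /adm_Es /= EsE.
apply: (le_trans _ (slope_le M0 h)); rewrite -eS.
by apply: ereal_inf_lbound; exists S.
Qed.

Lemma rhoCW_le_quadratic (x0 : V) (k : nat) M : 0 < M ->
  (forall y, E y -> norm2 (y - x0) <= k.+1%:R -> c y <= M) ->
  (rhoCW E x0 f G k.+1 <= M%:E)%E.
Proof.
move=> M0 h; apply: ereal_inf_lbound; exists M => //; split=> // y z x [Ey By] [Ez Bz].
apply: (le_trans (upper x Ey Ez)); rewrite lerD2l inorm_sqr ler_wpM2r ?dot_ge0//.
by rewrite ler_wpM2r ?invr_ge0// h.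
Qed.

(** The factor 2 is inherited from the gradient estimate. *)
Lemma rhoW_le_quadratic (x0 : V) (k : nat) M : 0 < M ->
  (forall y, E y -> norm2 (y - x0) <= k.+1%:R -> c y <= M) ->
  (forall x y, E x -> E y -> norm2 (G x - G y) <= 2 * c x * norm2 (x - y)) ->
  (rhoW E x0 f G k.+1 <= (2 * M)%:E)%E.
Proof.
move=> M0 h gl; apply: ereal_inf_lbound; exists (2 * M) => //; split.
  by rewrite mulr_gt0.
move=> x y [Ex Bx] [Ey By]; split; last first.
  by apply: (le_trans (gl _ _ Ex Ey)); rewrite ler_wpM2r ?inorm_ge0// ler_wpM2l// h.
rewrite inorm_sqr mulKf//.
have cy := ler_wpM2r (dot_ge0 (x - y)) (h _ Ey By).
have := upper x Ey Ex; have := upper x Ex Ey.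
rewrite subrr !dotr0.
have := mulr_ge0 (c_ge0 y) (dot_ge0 (x - y)).
move=> *; rewrite ger0_norm; lra.
Qed.

End Quadratic.

(** * The hyperbolas, and the corner forced at the origin *)

Definition hyperbolas (R : realType) : set 'rV[R]_2 :=
  [set x | (x 0 0 * x 0 1) ^+ 2 = 1].

Section Hyperbolas.
Variable R : realType.
Local Notation V := 'rV[R]_2.
Local Notation norm2 := (inorm (@dot R 2)).
Local Notation E := (@hyperbolas R).
Implicit Types (d : R) (x : V).

Lemma hyperbolas_closed : closed E.
Proof.
have -> : E = (fun x : V => (x 0 0 * x 0 1) * (x 0 0 * x 0 1)) @^-1` [set 1].
  by apply/seteqP; split => x; rewrite /hyperbolas /= expr2.
have c i : continuous (fun y : V => y 0 i) by exact: coord_continuous.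
have c2 : continuous (fun y : V => y 0 0 * y 0 1).
  move=> x; exact: (@continuousM R V _ _ x (c 0 x) (c 1 x)).
have c4 : continuous (fun y : V => y 0 0 * y 0 1 * (y 0 0 * y 0 1)).
  move=> x; exact: (@continuousM R V _ _ x (c2 x) (c2 x)).
apply: preimage_closed (@closed_eq R 1) => x _; exact: c4.
Qed.

Lemma hyperbolas_vec2 a b : (a * b) ^+ 2 = 1 -> E (vec2 a b).
Proof. by rewrite /hyperbolas /= !vec2E. Qed.

Lemma hyp1_bounds d : 0 < d <= 1 -> 1 <= hyp d 1 <= 2.
Proof.
move=> /andP[d0 d1]; apply/andP; split.
  by rewrite (le_trans _ (norm_le_hyp d 1))// normr1.
rewrite -[leRHS]ger0_norm// -sqrtr_sqr ler_wsqrtr//.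
have : d ^+ 2 <= 1 by rewrite exprn_ile1 ?(ltW d0).
by lra.
Qed.

(** The steep part near the vertical axis is far out on [E]: the bound is independent of [d] and
    finite on bounded sets. The summand 1 takes care of [d ^+ 3]. *)
Lemma hyperbolas_curvature d x : 0 < d <= 1 -> E x ->
  d ^+ 3 <= 1 + `|x 0 1| /\ (hyp d (x 0 0))^-1 <= 1 + `|x 0 1|.
Proof.
move=> /andP[d0 d1] Ex; split.
  by rewrite ler_wpDr// exprn_ile1 ?(ltW d0).
have e : `|x 0 0| * `|x 0 1| = 1.
  rewrite -normrM; apply/eqP; rewrite -sqrp_eq1 ?normr_ge0//.
  by rewrite real_normK ?num_real//; apply/eqP.
have x0 : 0 < `|x 0 0|.
  rewrite normr_gt0; apply/eqP => z; move: e.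
  by rewrite z normr0 mul0r => /esym/eqP; rewrite oner_eq0.
have -> : `|x 0 1| = `|x 0 0|^-1 by rewrite -[LHS](mulKf (lt0r_neq0 x0)) e mulr1.
apply: (le_trans (y := `|x 0 0|^-1)); last by rewrite lerDr.
by rewrite lef_pV2 ?posrE ?hyp_gt0// norm_le_hyp.
Qed.

(** Flipping the sign of one coordinate isolates each axis direction; the vertical one is nonzero
    thanks to the term d^3 h^2 / 2. *)
Lemma hyperbolas_span d : 0 < d -> is_span (diffs E (hypG d)) fullv.
Proof.
move=> d0; apply: (@is_span_fullv _ _ (2 / hyp d 1) (2 * d ^+ 3)).
- by rewrite mulf_neq0 ?invr_neq0 ?lt0r_neq0 ?hyp_gt0.
- by rewrite mulf_neq0 ?lt0r_neq0 ?exprn_gt0.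
- exists (vec2 1 1), (vec2 (-1) 1); split; try by apply: hyperbolas_vec2; ring.
  apply/rowP => i; rewrite !mxE /=.
  by case: (i == 0); rewrite /hyp ?sqrrN; ring.
- exists (vec2 1 1), (vec2 1 (-1)); split; try by apply: hyperbolas_vec2; ring.
  by apply/rowP => i; rewrite !mxE /=; case: (i == 0); ring.
Qed.

(** The second difference of [H] at the origin with step [s] along the horizontal axis is at least
    (s - d) - 6 d and at most 2 L s^2. As [d] tends to 0 this fails for small [s]. *)
Lemma second_difference (H : V -> R) d L s :
  0 < d <= 1 -> 0 < s <= 2^-1 -> 0 <= L ->
  convex_C11loc H -> interpolates E H (hypF d) (hypG d) ->
  (forall u v, cball (@dot R 2) (vec2 1 1) 2 u -> cball (@dot R 2) (vec2 1 1) 2 v ->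
     norm2 (grad (@dot R 2) H u - grad (@dot R 2) H v) <= L * norm2 (u - v)) ->
  s <= 7 * d + 2 * L * s ^+ 2.
Proof.
move=> /andP[d0 d1] /andP[s0 s1] L0 [cH [dH _]] HE lipH.
have d3 : d ^+ 3 <= d.
  by rewrite exprS ler_piMr ?(ltW d0)// exprn_ile1 ?(ltW d0).
have tg y x : H y + dot (grad (@dot R 2) H y) (x - y) <= H x.
  exact: convex_tangent.
have H0 : H 0 <= 3 * d.
  (* The sign [a] treats both points at once; the value there is sqrt(2) d + d / 2. *)
  have Hp a : a = 1 \/ a = -1 -> H (vec2 (a * d) (a / d)) <= 3 * d.
    move=> ha; have a2 : a ^+ 2 = 1 by case: ha => ->; ring.
    have Ep : E (vec2 (a * d) (a / d)).
      apply: hyperbolas_vec2.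
      have -> : a * d * (a / d) = a ^+ 2 by field; rewrite gt_eqF.
      by rewrite a2 expr1n.
    rewrite (HE _ Ep).1 /hypF !vec2E.
    have -> : d ^+ 3 / 2 * (a / d) ^+ 2 = a ^+ 2 * (d / 2) by field; rewrite gt_eqF.
    have : hyp d (a * d) <= 2 * d.
      rewrite -[leRHS]ger0_norm ?mulr_ge0 ?(ltW d0)// -sqrtr_sqr ler_wsqrtr//.
      by rewrite !exprMn a2; have := sqr_ge0 d; lra.
    by rewrite a2; lra.
  have := (convex_functionTP H).1 cH 2^-1 (vec2 (1 * d) (1 / d)) (vec2 (-1 * d) (-1 / d)).
  have -> : 2^-1 *: vec2 (1 * d) (1 / d) + (1 - 2^-1) *: vec2 (-1 * d) (-1 / d) = 0.
    by apply/rowP => i; rewrite !mxE; case: ifP => _; field; rewrite ?gt_eqF.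
  have h12 : (0 <= 2^-1 :> R) && (2^-1 <= 1 :> R) by apply/andP; split; lra.
  have := Hp _ (or_introl erefl); have := Hp _ (or_intror erefl).
  by move=> ? ? /(_ h12); lra.
(* The tangent plane at (a s, 0), evaluated at the origin. *)
have key a : H (vec2 (a * s) 0) <=
    H 0 + s * a * grad (@dot R 2) H (vec2 (a * s) 0) 0 0.
  have := tg (vec2 (a * s) 0) 0; move: (grad _ _ _) => g.
  by rewrite dotE !mxE /=; lra.
have /andP[r1 r2] : 1 <= hyp d 1 <= 2 by apply: hyp1_bounds; rewrite d0.
(* The tangent plane at (a, 1) has slope of modulus 1 / hyp d 1 >= 1/2 along the axis; its vertical
   part costs d^3 / 2 <= d / 2. *)
have lower a : a = 1 \/ a = -1 -> s / 2 - d / 2 <= H (vec2 (a * s) 0).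
  move=> ha; have a2 : a ^+ 2 = 1 by case: ha => ->; ring.
  have Ea : E (vec2 a 1) by apply: hyperbolas_vec2; rewrite mulr1.
  have := tg (vec2 a 1) (vec2 (a * s) 0).
  rewrite (HE _ Ea).1 (HE _ Ea).2 /hypF dotE /hypG !mxE /=.
  have -> : hyp d a = hyp d 1 by rewrite /hyp a2 expr1n.
  have -> : a / hyp d 1 * (a * s - a) = a ^+ 2 * ((s - 1) / hyp d 1).
    by field; rewrite gt_eqF// (lt_le_trans _ r1).
  rewrite a2 mulrBl => h; apply: (le_trans _ h).
  have i1 : (hyp d 1)^-1 <= 1 by rewrite invf_le1// (lt_le_trans _ r1).
  have : s / 2 <= s / hyp d 1.
    by rewrite ler_pM2l// lef_pV2 ?posrE// (lt_le_trans _ r1).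
  lra.
(* For s <= 1/2 the squared distance is at most (3/2)^2 + 1 < 4; hence the radius 2. *)
have inB a : a = 1 \/ a = -1 -> cball (@dot R 2) (vec2 1 1) 2 (vec2 (a * s) 0).
  move=> ha; rewrite /cball /= -[leRHS]ger0_norm// -sqrtr_sqr ler_wsqrtr//.
  rewrite dotE !mxE /=; have : 0 <= s * (2^-1 - s).
    by rewrite mulr_ge0 ?subr_ge0// ltW.
  by case: ha => ->; lra.
have p1 := inB _ (or_introl erefl); have p2 := inB _ (or_intror erefl).
have := lipH _ _ p1 p2.
have := coord_le_inorm (grad (@dot R 2) H (vec2 (1 * s) 0) -
  grad (@dot R 2) H (vec2 (-1 * s) 0)) 0.
have : norm2 (vec2 (1 * s) 0 - vec2 (-1 * s) 0) <= 2 * s.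
  apply: (le_trans (inorm_le_coords _)); rewrite !mxE /= subrr normr0 addr0.
  by rewrite ger0_norm; lra.
move=> /(ler_wpM2l L0) n1 n2 n3.
have := le_trans (ler_norm _) (le_trans n2 (le_trans n3 n1)).
rewrite !mxE => /(ler_wpM2l (ltW s0)) n4.
have arith (h0 h1 h2 g1 g2 : R) : h0 <= 3 * d ->
    s / 2 - d / 2 <= h1 -> s / 2 - d / 2 <= h2 ->
    h1 <= h0 + s * 1 * g1 -> h2 <= h0 + s * -1 * g2 ->
    s * (g1 - g2) <= s * (L * (2 * s)) -> s <= 7 * d + 2 * L * s ^+ 2.
  by clear; lra.
exact: (arith _ _ _ _ _ H0 (lower _ (or_introl erefl)) (lower _ (or_intror erefl))
  (key 1) (key (-1)) n4).
Qed.

End Hyperbolas.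

Theorem proposition3p1 (R : realType) :
  exists (E : set 'rV[R]_2) (x0 : 'rV[R]_2)
         (f : nat -> 'rV[R]_2 -> R) (G : nat -> 'rV[R]_2 -> 'rV[R]_2),
    [/\ closed E,
        E x0,
        exists F : nat -> 'rV[R]_2 -> R,
          forall j, convex_C11loc (F j) /\ interpolates E (F j) (f j) (G j),
        forall k : nat,
          [/\ (ereal_sup (range (fun j => rhoW E x0 (f j) (G j) k)) < +oo)%E,
              (ereal_sup (range (fun j => rhoCW E x0 (f j) (G j) k)) < +oo)%E &
              (ereal_sup (range (fun j => mu E x0 (f j) (G j) k)) < +oo)%E] &
        forall H : nat -> 'rV[R]_2 -> R,
          (forall j, convex_C11loc (H j) /\ interpolates E (H j) (f j) (G j)) ->
          exists2 k : nat, (1 <= k)%N &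
            ereal_sup (range (fun j => rho x0 k (H j))) = +oo%E].
Proof.
pose d (j : nat) : R := j.+1%:R^-1.
have d01 j : 0 < d j <= 1.
  by rewrite invr_gt0 ltr0n /= invf_le1 ?ltr0n// ler1n.
have d0 j : 0 < d j by have /andP[] := d01 j.
exists (@hyperbolas R), (vec2 1 1), (fun j => hypF (d j)), (fun j => hypG (d j)).
split.
- exact: hyperbolas_closed.
- by apply: hyperbolas_vec2; ring.
- exists (fun j => hypF (d j)) => j; split; first exact: hypF_convex_C11loc.
  by move=> x _; split=> //; exact: (hypF_grad (d0 j) x).2.
(* The curvature does not depend on [j], which makes all bounds below uniform. *)
- pose c (x : 'rV[R]_2) := 1 + `|x 0 1|.
  have c0 x : 0 <= c x by rewrite addr_ge0.
  have sup_fin (u : nat -> \bar R) (M : R) : (forall j, u j <= M%:E)%E ->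
      (ereal_sup (range u) < +oo)%E.
    move=> uM; apply: (@le_lt_trans _ _ M%:E); last exact: ltry.
    by apply: ge_ereal_sup => _ [j _ <-].
  have upper j y z x : hyperbolas y -> hyperbolas z ->
      hypF (d j) z + dot (hypG (d j) z) (x - z) <=
      hypF (d j) y + dot (hypG (d j) y) (x - y) + c y / 2 * dot (x - y) (x - y).
    move=> Ey _; have [h1 h2] := hyperbolas_curvature (d01 j) Ey.
    by apply: (le_trans (hypF_tangent (d0 j) z x)); exact: hypF_upper.
  have cB k y : inorm (@dot R 2) (y - vec2 1 1) <= k -> c y <= 2 + k.
    move=> h; have := le_trans (coord_le_inorm _ 1) h.
    rewrite !mxE /= => h'; have := ler_normD (y 0 1 - 1) 1.
    by rewrite subrK normr1 /c; lra.
  move=> [|k].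
    (* For k = 0 all three constants are [rho0]: the value at (1, 1) is at most 5/2 and the gradient
       has norm at most 2. *)
    have rho0_le j : (rho0 (vec2 1 1) (hypF (d j)) (hypG (d j)) <= 5%:E)%E.
      have /andP[r1 r2] := hyp1_bounds (d01 j).
      have d3 : 0 <= d j ^+ 3 by rewrite exprn_ge0 ?ltW.
      have d31 : d j ^+ 3 <= 1.
        by have /andP[_ d1] := d01 j; rewrite exprn_ile1// ltW.
      have i1 : (hyp (d j) 1)^-1 <= 1 by rewrite invf_le1// (lt_le_trans _ r1).
      have i0 : 0 <= (hyp (d j) 1)^-1 by rewrite invr_ge0 (le_trans _ r1).
      rewrite lee_fin; apply: (le_trans (lerD (lexx _) (inorm_le_coords _))).
      rewrite /hypF /hypG !vec2E expr1n !mulr1 mul1r.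
      by rewrite !ger0_norm//; lra.
    by split; apply: (sup_fin _ 5).
  have M0 : 0 < 2 + k.+1%:R :> R by rewrite ltr_wpDr.
  split.
  + apply: (sup_fin _ (2 * (2 + k.+1%:R))) => j.
    apply: (rhoW_le_quadratic c0 (upper j)) => // [y _|x y Ex Ey]; first exact: cB.
    have [h1 h2] := hyperbolas_curvature (d01 j) Ex.
    exact: hypG_lip.
  + apply: (sup_fin _ (2 + k.+1%:R)) => j.
    by apply: (rhoCW_le_quadratic (upper j)) => // y _; exact: cB.
  + apply: (sup_fin _ (2 + k.+1%:R)) => j.
    apply: (mu_le_quadratic (hyperbolas_span (d0 j)) c0 (upper j)).
    * move=> r; exists (1 + `|r|) => [|y _ yr]; first by rewrite addr_ge0.
      rewrite lerD2l; apply: (le_trans (coord_le_inorm y 1)).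
      exact: (le_trans yr (ler_norm r)).
    * exact: ltW.
    * by move=> y _; exact: cB.
move=> H HH; exists 2%N => //; apply/eqP; rewrite -leye_eq leNgt; apply/negP => fin.
set S := ereal_sup _ in fin.
have Sj j : (rho (vec2 1 1) 2 (H j) <= S)%E.
  by apply: ereal_sup_ubound; exists j.
(* Nonnegativity comes from the 0 adjoined in [esup0]. *)
have S0 : (0 <= S)%E.
  by apply: (le_trans _ (Sj 0)); apply: ereal_sup_ubound; left.
have SE : S = (fine S)%:E by rewrite fineK// ge0_fin_numE.
pose L := fine S.
have L0 : 0 <= L by exact: fine_ge0.
(* With this choice 2 L s^2 <= s / 2, so [second_difference] reduces to s <= 14 d_j. *)
pose s : R := (4 * (L + 1))^-1.
have s0 : 0 < s by rewrite invr_gt0 mulr_gt0// ltr_wpDl.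
have sL : s * (4 * (L + 1)) = 1 by rewrite mulVf// gt_eqF// mulr_gt0// ltr_wpDl.
have s12 : s <= 2^-1 by have := mulr_ge0 (ltW s0) L0; lra.
have key j : s <= 14 * d j.
  have [cH iH] := HH j.
  have := second_difference (d01 j) (introT andP (conj s0 s12)) L0 cH iH.
  have lip : (Lip (@dot R 2) (grad (@dot R 2) (H j)) (cball (@dot R 2) (vec2 1 1) 2)
     <= L%:E)%E by rewrite -SE; exact: Sj.
  move=> /(_ (Lip_ge_dist lip)).
  have := mulr_ge0 (ltW s0) (ltW s0).
  have : 2 * L * s ^+ 2 + 2 * (s * s) = s * (s * (4 * (L + 1))) / 2 by field.
  rewrite sL; lra.
(* An index N > 14 / s gives 14 d_N < s, a contradiction. *)
have := archi_boundP (divr_ge0 (ler0n R 14) (ltW s0)).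
set N := Num.bound _ => hN; have := key N.
rewrite leNgt => /negP; apply; rewrite /d -/(_ / _) ltr_pdivrMr ?ltr0n//.
by rewrite mulrC -ltr_pdivrMr// (lt_trans hN)// ltr_nat.
Qed.
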